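(* Let $(\mathcal{A},\mu,\alpha,B)$ be a quadratic Hom-Novikov algebra, where $\alpha$ is an involution ($\alpha^2=\mathrm{id}$) satisfying $B(\alpha(x),y)=B(x,\alpha(y))$ for all $x,y\in\mathcal{A}$. Then $(\mathcal{A},\star,B)$ with $\star=\alpha\circ\mu$, i.e. $x\star y=\alpha(\mu(x,y))$, is a quadratic Novikov algebra.
   Context: All vector spaces are over a field $\mathbb{F}$ of characteristic zero. A Novikov algebra $(\mathcal{A},\mu)$ is a vector space with a bilinear product $\mu(x,y)=xy$ satisfying $(xy)z=(xz)y$ and $(xy)z-x(yz)=(yx)z-y(xz)$ for all $x,y,z\in\mathcal{A}$. A quadratic Novikov algebra $(\mathcal{A},\mu,B)$ is a Novikov algebra with a symmetric nondegenerate bilinear form $B:\mathcal{A}\times\mathcal{A}\to\mathbb{F}$ that is invariant: $B(xy,z)=B(x,yz)$ for all $x,y,z\in\mathcal{A}$. A Hom-Novikov algebra is a triple $(\mathcal{A},\mu,\alpha)$ consisting of a vector space $\mathcal{A}$, a bilinear map $\mu:\mathcal{A}\times\mathcal{A}\to\mathcal{A}$, $\mu(x,y)=xy$, and an algebra homomorphism $\alpha:\mathcal{A}\to\mathcal{A}$ (linear with $\alpha(xy)=\alpha(x)\alpha(y)$) such that for all $x,y,z\in\mathcal{A}$: $(xy)\alpha(z)=(xz)\alpha(y)$ and $(xy)\alpha(z)-\alpha(x)(yz)=(yx)\alpha(z)-\alpha(y)(xz)$. A quadratic Hom-Novikov algebra $(\mathcal{A},\mu,\alpha,B)$ is a Hom-Novikov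 algebra $(\mathcal{A},\mu,\alpha)$ with a symmetric nondegenerate bilinear form $B:\mathcal{A}\times\mathcal{A}\to\mathbb{F}$ satisfying $B(xy,\alpha(z))=B(\alpha(x),yz)$ for all $x,y,z\in\mathcal{A}$. *)

(* Defs.v *)
From HB Require Import structures.
From mathcomp Require Import all_boot all_order all_algebra.

Set Implicit Arguments.
Unset Strict Implicit.
Unset Printing Implicit Defensive.

Import GRing.Theory.
Local Open Scope ring_scope.

Section NovikovAlgebras.
Variables (F : fieldType) (A : lmodType F).
Implicit Types (mu : A -> A -> A) (alpha : A -> A) (B : A -> A -> F).

Record is_novikov mu : Prop := IsNovikov {
  novikov_bilinear : bilinear_for *:%R *:%R mu;
  novikov_right_comm : forall x y z, mu (mu x y) z = mu (mu x z) y;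
  novikov_left_sym : forall x y z,
    mu (mu x y) z - mu x (mu y z) = mu (mu y x) z - mu y (mu x z) }.

Record is_hom_novikov mu alpha : Prop := IsHomNovikov {
  hom_novikov_bilinear : bilinear_for *:%R *:%R mu;
  hom_novikov_linear : linear alpha;
  hom_novikov_morph : forall x y, alpha (mu x y) = mu (alpha x) (alpha y);
  hom_novikov_right_comm : forall x y z,
    mu (mu x y) (alpha z) = mu (mu x z) (alpha y);
  hom_novikov_left_sym : forall x y z,
    mu (mu x y) (alpha z) - mu (alpha x) (mu y z)
      = mu (mu y x) (alpha z) - mu (alpha y) (mu x z) }.

(* [A] may be infinite-dimensional, so the form is not taken from [vectType]
   theory; nondegenerate means trivial radical (left and right radicals
   coincide by symmetry). *)
Record is_sym_nondeg_form B : Prop := IsSymNondegForm {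
  form_bilinear : bilinear_for *%R *%R B;
  form_sym : forall x y, B x y = B y x;
  form_nondeg : forall x, (forall y, B x y = 0) -> x = 0 }.

Record is_quadratic_novikov mu B : Prop := IsQuadraticNovikov {
  quadratic_novikov : is_novikov mu;
  quadratic_novikov_form : is_sym_nondeg_form B;
  quadratic_novikov_invariant : forall x y z, B (mu x y) z = B x (mu y z) }.

Record is_quadratic_hom_novikov mu alpha B : Prop := IsQuadraticHomNovikov {
  quadratic_hom_novikov : is_hom_novikov mu alpha;
  quadratic_hom_novikov_form : is_sym_nondeg_form B;
  quadratic_hom_novikov_invariant : forall x y z,
    B (mu x y) (alpha z) = B (alpha x) (mu y z) }.

End NovikovAlgebras.

(* Main.v *)
Require Import Defs.
From HB Require Import structures.
From mathcomp Require Import all_boot all_order all_algebra.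

Import GRing.Theory.
Local Open Scope ring_scope.

(** Write x * y for the twisted product alpha (mu x y). Since alpha is a
    multiplicative involution, the outer twist of an iterated product cancels
    the inner one:
    (x * y) * z = mu (mu x y) (alpha z) and x * (y * z) = mu (alpha x) (mu y z).
    These are exactly the terms of the Hom-Novikov identities, which therefore
    become the Novikov identities of the twisted product. The form is the same,
    and its invariance follows by moving alpha across it:
    B (x * y) z = B (mu x y) (alpha z) = B (alpha x) (mu y z) = B x (y * z). *)

Lemma twisted_bilinear (F : fieldType) (A : lmodType F) (mu : A -> A -> A)
    (alpha : A -> A) :
  bilinear_for *:%R *:%R mu -> linear alpha ->
  bilinear_for *:%R *:%R (fun x y => alpha (mu x y)).
Proof.
move=> [muDl muDr] alphaD; split=> [z a x y | z a x y] /=.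
  by rewrite (muDl z a x y) alphaD.
by rewrite (muDr z a x y) alphaD.
Qed.

Lemma twisted_novikov (F : fieldType) (A : lmodType F) (mu : A -> A -> A)
    (alpha : A -> A) :
  is_hom_novikov mu alpha -> involutive alpha ->
  is_novikov (fun x y => alpha (mu x y)).
Proof.
case=> mu_bil alpha_lin alphaM rcomm lsym alphaK.
have mulL x y z : alpha (mu (alpha (mu x y)) z) = mu (mu x y) (alpha z).
  by rewrite alphaM alphaK.
have mulR x y z : alpha (mu x (alpha (mu y z))) = mu (alpha x) (mu y z).
  by rewrite alphaM alphaK.
split=> [|x y z|x y z]; first exact: twisted_bilinear.
  by rewrite !mulL.
by rewrite !mulL !mulR.
Qed.

Theorem proposition4p5 (F : fieldType) (F_char0 : [pchar F] =i pred0)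
    (A : lmodType F) (mu : A -> A -> A) (alpha : A -> A) (B : A -> A -> F)
    (quadA : is_quadratic_hom_novikov mu alpha B)
    (alpha_invol : forall x : A, alpha (alpha x) = x)
    (alpha_selfadj : forall x y : A, B (alpha x) y = B x (alpha y)) :
  is_quadratic_novikov (fun x y : A => alpha (mu x y)) B.
Proof.
case: quadA => novA formB invB; split=> // [|x y z].
  exact: twisted_novikov.
by rewrite alpha_selfadj invB alpha_selfadj.
Qed.
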